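(* The theory of the structure $\langle\mathbb{Q}^+,1,\cdot,{}^{-1},R_2,R_3,\ldots\rangle$ admits quantifier elimination.
   Context: $\mathbb{Q}^+=\{r\in\mathbb{Q}: r>0\}$, with $1$, multiplication $\cdot$ and inverse ${}^{-1}$ interpreted as usual. For each integer $n\geq 2$, $R_n$ is a unary predicate interpreted as ''being the $n$-th power of a rational number'', i.e. $R_n(x)\iff\exists y\,[x=y^n]$. *)

(* Defs.v *)
From mathcomp Require Import all_boot all_order all_algebra.

Set Implicit Arguments.
Unset Strict Implicit.
Unset Printing Implicit Defensive.

Import Order.TTheory GRing.Theory Num.Theory.
Local Open Scope ring_scope.

Record language := Language {
  func : Type;
  func_arity : func -> nat;
  rel_symb : Type;
  rel_arity : rel_symb -> nat
}.

(* [term L n] and [formula L n] are well-scoped: their free variables are among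
   the [n] variables indexed by ['I_n]; a sentence is a [formula L 0]. *)
Inductive term (L : language) (n : nat) : Type :=
| Var of 'I_n
| App (f : func L) of ('I_(func_arity f) -> term L n).

Arguments Var {L n} _.
Arguments App {L n} f _.

(* Quantifiers bind the variable [ord0] of their body (de Bruijn indices). *)
Inductive formula (L : language) : nat -> Type :=
| FFalse n : formula L n
| FEq n : term L n -> term L n -> formula L n
| FRel n (r : rel_symb L) : ('I_(rel_arity r) -> term L n) -> formula L n
| FAnd n : formula L n -> formula L n -> formula L n
| FOr n : formula L n -> formula L n -> formula L n
| FImp n : formula L n -> formula L n -> formula L n
| FAll n : formula L n.+1 -> formula L n
| FEx n : formula L n.+1 -> formula L n.

Arguments FFalse {L n}.
Arguments FRel {L n} r _.

(* Negation is [FImp phi FFalse]. *)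
Definition FIff (L : language) (n : nat) (phi psi : formula L n) : formula L n :=
  FAnd (FImp phi psi) (FImp psi phi).

Fixpoint quantifier_free (L : language) (n : nat) (phi : formula L n) : bool :=
  match phi with
  | FFalse _ | FEq _ _ _ | FRel _ _ _ => true
  | FAnd _ p q | FOr _ p q | FImp _ p q => quantifier_free p && quantifier_free q
  | FAll _ _ | FEx _ _ => false
  end.

Record structure (L : language) := Structure {
  carrier :> Type;
  carrier_inhabited : inhabited carrier;
  func_interp : forall f : func L, ('I_(func_arity f) -> carrier) -> carrier;
  rel_interp : forall r : rel_symb L, ('I_(rel_arity r) -> carrier) -> Prop
}.

Fixpoint eval (L : language) (M : structure L) (n : nat) (v : 'I_n -> M)
    (t : term L n) : M :=
  match t with
  | Var i => v i
  | App f ts => func_interp (fun i => eval v (ts i))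
  end.

Definition extend (T : Type) (n : nat) (x : T) (v : 'I_n -> T) : 'I_n.+1 -> T :=
  fun i => if unlift ord0 i is Some j then v j else x.

Fixpoint sat (L : language) (M : structure L) (n : nat) (phi : formula L n) :
    ('I_n -> M) -> Prop :=
  match phi in formula _ n return ('I_n -> M) -> Prop with
  | FFalse _ => fun _ => False
  | FEq _ s t => fun v => eval v s = eval v t
  | FRel _ r ts => fun v => rel_interp (fun i => eval v (ts i))
  | FAnd _ p q => fun v => sat p v /\ sat q v
  | FOr _ p q => fun v => sat p v \/ sat q v
  | FImp _ p q => fun v => sat p v -> sat q v
  | FAll _ p => fun v => forall x : M, sat p (extend x v)
  | FEx _ p => fun v => exists x : M, sat p (extend x v)
  end.

Definition no_var (T : Type) (i : 'I_0) : T :=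
  match notF (ltn_ord i) with end.

Definition holds (L : language) (M : structure L) (phi : formula L 0) : Prop :=
  sat phi (@no_var M).

Definition theory (L : language) := formula L 0 -> Prop.

Definition theory_of (L : language) (M : structure L) : theory L :=
  fun phi => holds M phi.

Definition model_of (L : language) (T : theory L) (M : structure L) : Prop :=
  forall phi, T phi -> holds M phi.

(* Free variables of [phi] are read as universally quantified. *)
Definition entails (L : language) (T : theory L) (n : nat) (phi : formula L n) :
    Prop :=
  forall M : structure L, model_of T M -> forall v : 'I_n -> M, sat phi v.

Definition admits_quantifier_elimination (L : language) (T : theory L) : Prop :=
  forall (n : nat) (phi : formula L n),
    exists psi : formula L n, quantifier_free psi /\ entails T (FIff phi psi).

Variant mul_func := OneSymb | MulSymb | InvSymb.

Definition mul_func_arity (f : mul_func) : nat :=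
  match f with OneSymb => 0 | MulSymb => 2 | InvSymb => 1 end.

(* The relation symbols are the [R_n] for [n >= 2], all unary. *)
Definition mul_language : language :=
  {| func := mul_func;
     func_arity := mul_func_arity;
     rel_symb := {n : nat | (2 <= n)%N};
     rel_arity := fun _ => 1%N |}.

Definition Qpos := {r : rat | 0 < r}.

Definition Qpos_one : Qpos := exist _ 1 ltr01.

Definition Qpos_mul (x y : Qpos) : Qpos :=
  exist _ (val x * val y) (mulr_gt0 (valP x) (valP y)).

Lemma Qpos_inv_subproof (x : Qpos) : 0 < (val x)^-1.
Proof. by rewrite invr_gt0; exact: valP. Qed.

Definition Qpos_inv (x : Qpos) : Qpos := exist _ (val x)^-1 (Qpos_inv_subproof x).

Definition Qpos_power (n : nat) (x : Qpos) : Prop :=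
  exists y : rat, val x = y ^+ n.

Definition Qpos_func (f : mul_func) : ('I_(mul_func_arity f) -> Qpos) -> Qpos :=
  match f with
  | OneSymb => fun _ => Qpos_one
  | MulSymb => fun a => Qpos_mul (a ord0) (a ord_max)
  | InvSymb => fun a => Qpos_inv (a ord0)
  end.

Definition Qpos_structure : structure mul_language :=
  {| carrier := Qpos : Type;
     carrier_inhabited := inhabits Qpos_one;
     func_interp := Qpos_func : forall f : func mul_language, _;
     rel_interp := fun (r : rel_symb mul_language) (a : 'I_1 -> Qpos) =>
       Qpos_power (sval r) (a ord0) |}.

(* Main.v *)
(* Written additively, the positive rationals form a torsion-free abelian group
   G, and up to multiplying through by nonzero integers every atom says that an
   integer combination of the variables lies in mG, the case m = 0 being an
   equation. Clearing coefficients, an existential quantifier over a conjunction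
   of literals asks for u with u = t_i mod n_i G and u <> s_j mod m_j G. By the
   Chinese remainder theorem the congruences are solvable iff they are pairwise
   compatible, t_i = t_k mod gcd(n_i, n_k) G, and the solutions form a class
   modulo NG with N = lcm(n_i). Adding to u the N-fold of a prime that occurs in
   none of the data meets every incongruence with m_j not dividing N; when m_j
   divides N, the class lies in s_j + m_j G or misses it, and it lies in it iff
   u = s_j mod m_j G is compatible with all the congruences. *)
From HB Require Import structures.
From mathcomp Require Import all_boot all_order all_algebra.
From Stdlib Require Import Classical FunctionalExtensionality.
Require Import Defs.

Set Implicit Arguments.
Unset Strict Implicit.
Unset Printing Implicit Defensive.

Import Order.TTheory GRing.Theory Num.Theory.
Local Open Scope ring_scope.

(** * Distributivity of gcd over lcm *)

Lemma gcdn_lcmr (m n p : nat) : gcdn m (lcmn n p) = lcmn (gcdn m n) (gcdn m p).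
Proof. exact: (@Order.DistrLatticeTheory.meetUr _ natdvd). Qed.

Lemma gcdn_biglcmr (T : Type) (m : nat) (s : seq T) (F : T -> nat) :
  gcdn m (\big[lcmn/1%N]_(i <- s) F i) = \big[lcmn/1%N]_(i <- s) gcdn m (F i).
Proof.
elim: s => [|x s IHs]; first by rewrite !big_nil gcdn1.
by rewrite !big_cons gcdn_lcmr IHs.
Qed.

Lemma dvdn_biglcm_in (T : eqType) (s : seq T) (F : T -> nat) x :
  x \in s -> (F x %| \big[lcmn/1%N]_(i <- s) F i)%N.
Proof.
elim: s => // y s IHs; rewrite inE big_cons => /orP[/eqP-> | /IHs].
  exact: dvdn_lcml.
by move=> dvd_s; apply: dvdn_trans dvd_s (dvdn_lcmr _ _).
Qed.

(** * Congruences in torsion-free abelian groups *)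

Definition multiple (V : zmodType) (n : nat) (x : V) : Prop :=
  exists y : V, x = y *+ n.

Definition torsion_free (V : zmodType) : Prop :=
  forall (n : nat) (x : V), (0 < n)%N -> x *+ n = 0 -> x = 0.

Section Multiples.

Variable V : zmodType.
Implicit Types (x y : V) (m n : nat).

Lemma multiple0P x : multiple 0 x <-> x = 0.
Proof. by split=> [[y ->]|->]; [rewrite mulr0n | exists 0]. Qed.

Lemma multiple1 x : multiple 1 x.
Proof. by exists x. Qed.

Lemma multiple_muln x n : multiple n (x *+ n).
Proof. by exists x. Qed.

Lemma multipleD n x y : multiple n x -> multiple n y -> multiple n (x + y).
Proof. by move=> [a ->] [b ->]; exists (a + b); rewrite mulrnDl. Qed.

Lemma multipleN n x : multiple n (- x) <-> multiple n x.
Proof.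
split=> -[a]; last by move=> ->; exists (- a); rewrite mulNrn.
by move/eqP; rewrite eqr_oppLR -mulNrn => /eqP->; exists (- a).
Qed.

Lemma multiple_subC n x y : multiple n (x - y) -> multiple n (y - x).
Proof. by rewrite -(opprB x y) => /multipleN. Qed.

Lemma multiple_sub_trans n x y z :
  multiple n (x - y) -> multiple n (y - z) -> multiple n (x - z).
Proof. by move=> mxy myz; have := multipleD mxy myz; rewrite addrA subrK. Qed.

Lemma multiple_dvd m n x : (m %| n)%N -> multiple n x -> multiple m x.
Proof. by move=> /dvdnP[k ->] [y ->]; exists (y *+ k); rewrite mulrnA. Qed.

Lemma mulrn_Bezout x m n :
  exists a b : int, x *+ gcdn m n = x *~ (a * m) + x *~ (b * n).
Proof.
have [a [b abE]] := Bezoutz m n.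
by exists a, b; rewrite -mulrzDr abE pmulrn.
Qed.

(** A Bezout relation splits [x - y] into an [m]-fold and an [n]-fold multiple; subtracting the
    former from [x] gives [u]. *)
Lemma chinese_multiple m n x y : multiple (gcdn m n) (x - y) ->
  exists u, multiple m (u - x) /\ multiple n (u - y).
Proof.
move=> [g gE]; have [a [b]] := mulrn_Bezout g m n.
rewrite -gE !mulrzA -!pmulrn => abE.
exists (x - g *~ a *+ m); split.
  by rewrite addrC addKr; apply/multipleN; exists (g *~ a).
exists (g *~ b); rewrite addrAC.
by rewrite abE addrC addKr.
Qed.

Hypothesis tfV : torsion_free V.

Lemma torsion_free_inj n : (0 < n)%N -> injective (fun x => x *+ n).
Proof.
move=> n_gt0 x y /eqP; rewrite -subr_eq0 -mulrnBl => /eqP /(tfV n_gt0).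
by move/eqP; rewrite subr_eq0 => /eqP.
Qed.

(** In [x = g m = h n], torsion-freeness cancels [d = gcdn m n], so [g (m/d) = h (n/d)]. Bezout for
    the coprime quotients then makes [g] a multiple of [n/d], and [lcmn m n = (n/d) m]. *)
Lemma multiple_lcm m n x : multiple m x -> multiple n x -> multiple (lcmn m n) x.
Proof.
have [->|m_gt0] := posnP m; first by rewrite lcm0n.
move=> [g gE] [h hE]; pose d := gcdn m n.
have d_gt0 : (0 < d)%N by rewrite gcdn_gt0 m_gt0.
have [mE nE] : m = (m %/ d * d)%N /\ n = (n %/ d * d)%N.
  by rewrite !divnK ?dvdn_gcdl ?dvdn_gcdr.
have lcmE : lcmn m n = (n %/ d * m)%N by rewrite mulnC muln_divA ?dvdn_gcdr.
have ghE : g *+ (m %/ d) = h *+ (n %/ d).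
  by apply: (torsion_free_inj d_gt0); rewrite -!mulrnA -mE -nE -gE.
have cop : gcdn (m %/ d) (n %/ d) = 1%N.
  by apply/eqP; rewrite -(eqn_pmul2r d_gt0) muln_gcdl -mE -nE mul1n.
have [a [b]] := mulrn_Bezout g (m %/ d) (n %/ d).
rewrite cop mulr1n [a * _]mulrC !mulrzA -!pmulrn ghE pmulrn -mulrzA mulrC mulrzA.
rewrite -pmulrn -mulrnDl => g2E.
by exists (h *~ a + g *~ b); rewrite lcmE mulrnA -g2E.
Qed.

Lemma multiple_biglcm (T : eqType) (s : seq T) (F : T -> nat) x :
  (forall i, i \in s -> multiple (F i) x) ->
  multiple (\big[lcmn/1%N]_(i <- s) F i) x.
Proof.
elim: s => [|i s IHs] mx; first by rewrite big_nil; apply: multiple1.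
rewrite big_cons; apply: multiple_lcm; first by apply: mx; rewrite mem_head.
by apply: IHs => j js; apply: mx; rewrite inE js orbT.
Qed.

(** Used to clear coefficients; torsion-freeness cancels [q]. *)
Lemma multiple_mulz (q : int) n x :
  q != 0 -> multiple n x <-> multiple (n * `|q|) (x *~ q).
Proof.
rewrite -absz_gt0 => q_gt0.
suff : multiple n x <-> multiple (n * `|q|) (x *+ `|q|).
  case: q {q_gt0} => k; first by rewrite /= pmulrn.
  move=> ->; rewrite NegzE mulrNz -pmulrn abszN /=.
  by split=> /multipleN.
split=> [[y ->]|[y]]; first by exists y; rewrite mulrnA.
by rewrite mulrnA => /(torsion_free_inj q_gt0)->; exists y.
Qed.

Lemma chinese_multiple_seq (s : seq (V * nat)) :
  (forall c d, c \in s -> d \in s -> multiple (gcdn c.2 d.2) (c.1 - d.1)) ->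
  exists u, forall c, c \in s -> multiple c.2 (u - c.1).
Proof.
elim: s => [|c s IHs] compat; first by exists 0.
have [|u uP] := IHs; first by move=> d e ds es; apply: compat; rewrite inE ?ds ?es orbT.
(* The tail counts as the single congruence to [u] modulo [N]. It is compatible with [c] because gcd
   distributes over the lcm [N]. *)
pose N := \big[lcmn/1%N]_(d <- s) d.2.
have /chinese_multiple[w [wc wu]] : multiple (gcdn c.2 N) (c.1 - u).
  rewrite gcdn_biglcmr; apply: multiple_biglcm => d ds.
  apply: (@multiple_sub_trans _ _ d.1).
    by apply: compat; rewrite inE ?eqxx ?ds ?orbT.
  by apply: multiple_subC; apply: multiple_dvd (uP _ ds); apply: dvdn_gcdr.
exists w => d; rewrite inE => /orP[/eqP-> //|ds].
apply: multiple_sub_trans (uP _ ds).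
by apply: multiple_dvd wu; apply: dvdn_biglcm_in ds.
Qed.

(* Finitely many elements are avoided at once by the multiples of a single
   element: in the positive rationals, a prime occurring in none of them. *)
Hypothesis fresh : forall s : seq V, exists w : V, forall a, a \in s ->
  forall m n, multiple m (a + w *+ n) -> (m %| n)%N.

(* Moduli may be [0], so that the congruences comprise the equations. *)
Lemma exists_congruences (P N : seq (V * nat)) :
  (exists u, (forall c, c \in P -> multiple c.2 (u - c.1)) /\
             (forall c, c \in N -> ~ multiple c.2 (u - c.1))) <->
  (forall c, c \in P -> forall d, d \in P ->
     multiple (gcdn c.2 d.2) (c.1 - d.1)) /\
  (forall d, d \in N -> (d.2 %| \big[lcmn/1%N]_(c <- P) c.2)%N ->
     ~ (forall c, c \in P -> multiple (gcdn c.2 d.2) (c.1 - d.1))).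
Proof.
set L := \big[lcmn/1%N]_(c <- P) c.2; split=> [[u [uP uN]]|[compat incompat]].
  split=> [c cP d dP|d dN dvd_dL compat].
    apply: (@multiple_sub_trans _ _ u).
      by apply: multiple_subC; apply: multiple_dvd (uP c cP); apply: dvdn_gcdl.
    by apply: multiple_dvd (uP d dP); apply: dvdn_gcdr.
  (* As [d.2] divides [L], it is the lcm of its gcds with the moduli in [P], so compatibility alone
     forces [u] into the class excluded by [d]. *)
  apply: (uN d dN); rewrite -(gcdn_idPl dvd_dL) gcdn_biglcmr.
  apply: multiple_biglcm => c cP.
  apply: (@multiple_sub_trans _ _ c.1).
    by apply: multiple_dvd (uP c cP); apply: dvdn_gcdr.
  by rewrite gcdnC; apply: compat.
have [u0 u0P] := chinese_multiple_seq (fun c d cP dP => compat c cP d dP).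
(* Adding [w *+ L] preserves the congruences in [P]; by freshness the result can lie in the class of
   [d] only if [d.2] divides [L]. *)
have [w wP] := fresh [seq u0 - d.1 | d <- N].
have uP c : c \in P -> multiple c.2 (u0 + w *+ L - c.1).
  move=> cP; rewrite addrAC; apply: multipleD (u0P c cP) _.
  by apply: multiple_dvd (multiple_muln w L); apply: dvdn_biglcm_in cP.
exists (u0 + w *+ L); split=> // d dN; rewrite addrAC => md.
have dvd_dL : (d.2 %| L)%N by apply: wP md; apply: map_f.
apply: (incompat d dN dvd_dL) => c cP.
apply: (@multiple_sub_trans _ _ (u0 + w *+ L)).
  by apply: multiple_subC; apply: multiple_dvd (uP c cP); apply: dvdn_gcdl.
by rewrite addrAC; apply: multiple_dvd md; apply: dvdn_gcdr.
Qed.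

End Multiples.

(** * The positive rationals as a torsion-free group *)

Lemma Qpos_addA : associative Qpos_mul.
Proof. by move=> x y z; apply: val_inj; rewrite /= mulrA. Qed.

Lemma Qpos_addC : commutative Qpos_mul.
Proof. by move=> x y; apply: val_inj; rewrite /= mulrC. Qed.

Lemma Qpos_add0 : left_id Qpos_one Qpos_mul.
Proof. by move=> x; apply: val_inj; rewrite /= mul1r. Qed.

Lemma Qpos_addN : left_inverse Qpos_one Qpos_inv Qpos_mul.
Proof. by move=> x; apply: val_inj; rewrite /= mulVf // gt_eqF // (valP x). Qed.

(* The group of positive rationals is written additively, so that its powers
   are the multiples [x *+ n] and [x *~ k]. *)
HB.instance Definition _ := Choice.on Qpos.
HB.instance Definition _ :=
  GRing.isZmodule.Build Qpos Qpos_addA Qpos_addC Qpos_add0 Qpos_addN.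

Lemma val_Qpos_mulrn (x : Qpos) (n : nat) : val (x *+ n) = val x ^+ n.
Proof. by elim: n => [|n IHn]; rewrite ?mulr0n // mulrS exprS -IHn. Qed.

(** A rational root [y] may be negative, but it is nonzero, and its absolute value is a root in
    [Qpos]. *)
Lemma Qpos_powerE (n : nat) (x : Qpos) :
  (0 < n)%N -> Qpos_power n x <-> multiple n x.
Proof.
move=> n_gt0; split=> [[y xE]|[y ->]]; last by exists (val y); rewrite val_Qpos_mulrn.
have y_neq0 : y != 0.
  by have := valP x; rewrite /= xE; apply: contraTneq => ->; rewrite expr0n gtn_eqF ?ltxx.
exists (exist _ `|y| (etrans (normr_gt0 y) y_neq0)); apply: val_inj.
by rewrite val_Qpos_mulrn /= -normrX -xE gtr0_norm // (valP x).
Qed.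

Lemma Qpos_torsion_free : torsion_free Qpos.
Proof.
move=> n x n_gt0 /(congr1 val); rewrite val_Qpos_mulrn /= => xE; apply: val_inj.
by apply/eqP; rewrite -(@pexpr_eq1 _ _ n) ?xE ?ltW ?(valP x).
Qed.

(** Its prime divisors are the primes with nonzero exponent in [x]. *)
Definition num_den (x : Qpos) : nat := (`|numq (val x)| * `|denq (val x)|)%N.

Lemma num_den_gt0 x : (0 < num_den x)%N.
Proof. by rewrite muln_gt0 !absz_gt0 denq_neq0 numq_eq0 gt_eqF // (valP x). Qed.

(** Compare exponents of [p] in [x p^n = y^m]: that of [x] is zero, so [n] is [m] times the exponent
    of [p] in [y]. *)
Lemma prime_multiple_dvd (p : nat) (p_gt0 : 0 < p%:R :> rat) (x : Qpos) (m n : nat) :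
  prime p -> coprime p (num_den x) ->
  multiple m (x + (exist _ p%:R p_gt0 : Qpos) *+ n) -> (m %| n)%N.
Proof.
rewrite coprimeMr => p_pr /andP[cop_num cop_den] [y /(congr1 val)].
rewrite val_Qpos_mulrn /= (val_Qpos_mulrn (exist _ _ _)) /= => xE.
have := num_den_gt0 x; have := num_den_gt0 y; rewrite !muln_gt0.
move=> /andP[ny_gt0 dy_gt0] /andP[nx_gt0 dx_gt0].
(* Denominators are cleared so that [logn] applies. *)
have natE : (`|numq (val x)| * p ^ n * `|denq (val y)| ^ m =
             `|numq (val y)| ^ m * `|denq (val x)|)%N.
  have dx0 : (denq (val x))%:~R != 0 :> rat by rewrite intr_eq0 denq_neq0.
  have dy0 : (denq (val y))%:~R != 0 :> rat by rewrite intr_eq0 denq_neq0.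
  have intE : numq (val x) * p%:R ^+ n * denq (val y) ^+ m =
              numq (val y) ^+ m * denq (val x).
    apply: (@intr_inj rat); rewrite !rmorphM !rmorphXn /= mulrz_nat.
    apply/eqP; rewrite -eqr_div ?expf_neq0 // mulrAC divq_num_den xE.
    by rewrite -expr_div_n divq_num_den.
  have := congr1 absz intE.
  by rewrite !abszM !abszX natz.
move/(congr1 (logn p)): natE.
rewrite !lognM ?muln_gt0 ?expn_gt0 ?ny_gt0 ?dy_gt0 ?nx_gt0 ?dx_gt0 ?(prime_gt0 p_pr) //.
rewrite !lognX (logn_coprime cop_num) (logn_coprime cop_den) logn_prime // eqxx.
rewrite add0n addn0 muln1 => logE.
by rewrite -(dvdn_addl n (dvdn_mulr (logn p `|denq (val y)|) (dvdnn m))) logE dvdn_mulr.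
Qed.

(** A prime exceeding the product of all [num_den a] divides none of them. *)
Lemma Qpos_fresh (s : seq Qpos) : exists w : Qpos, forall a, a \in s ->
  forall m n, multiple m (a + w *+ n) -> (m %| n)%N.
Proof.
have [p p_gt p_pr] := prime_above (\prod_(a <- s) num_den a).
have p_gt0 : 0 < p%:R :> rat by rewrite ltr0n prime_gt0.
exists (exist _ p%:R p_gt0 : Qpos) => a sa m n; apply: prime_multiple_dvd => //.
rewrite prime_coprime //; apply: contraL p_gt => dvd_pa; rewrite -leqNgt.
apply: dvdn_leq; first by apply: prodn_gt0 => b; apply: num_den_gt0.
by rewrite (big_rem a) //= dvdn_mulr.
Qed.

Lemma forall_in_map (S T : eqType) (f : S -> T) (s : seq S) (P : T -> Prop) :
  (forall y, y \in [seq f x | x <- s] -> P y) <-> (forall x, x \in s -> P (f x)).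
Proof.
by split=> [sP x xs|sP y /mapP[x xs ->]]; [apply: sP; apply: map_f | apply: sP].
Qed.

(** * Terms as integer linear combinations *)

Notation valuation n := ('I_n -> Qpos_structure).

(** Multiplicatively, the Laurent monomial with exponent vector [e]. *)
Definition lincomb (n : nat) (e : 'rV[int]_n) (v : 'I_n -> Qpos) : Qpos :=
  \sum_i v i *~ e 0 i.

Section LinearCombinations.

Variables (n : nat) (v : 'I_n -> Qpos).
Implicit Types e : 'rV[int]_n.

Lemma lincomb0 : lincomb 0 v = 0.
Proof. by apply: big1 => i _; rewrite mxE mulr0z. Qed.

Lemma lincombD e f : lincomb (e + f) v = lincomb e v + lincomb f v.
Proof. by rewrite -big_split /=; apply: eq_bigr => i _; rewrite mxE mulrzDr. Qed.

Lemma lincombN e : lincomb (- e) v = - lincomb e v.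
Proof. by rewrite -sumrN; apply: eq_bigr => i _; rewrite mxE mulrNz. Qed.

Lemma lincombB e f : lincomb (e - f) v = lincomb e v - lincomb f v.
Proof. by rewrite lincombD lincombN. Qed.

Lemma lincombZ (q : int) e : lincomb (q *: e) v = lincomb e v *~ q.
Proof.
by rewrite /lincomb mulrz_suml; apply: eq_bigr => i _; rewrite mxE mulrC mulrzA.
Qed.

Lemma lincomb_delta i : lincomb (delta_mx 0 i) v = v i.
Proof.
rewrite /lincomb (bigD1 i) //= mxE !eqxx mulr1z big1 ?addr0 // => j ji.
by rewrite mxE (negPf ji) andbF mulr0z.
Qed.

Lemma lincomb_extend (x : Qpos) (e : 'rV[int]_n.+1) :
  lincomb e (extend x v) = x *~ e 0 ord0 + lincomb (col' ord0 e) v.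
Proof.
rewrite /lincomb big_ord_recl /extend unlift_none; congr (_ + _).
by apply: eq_bigr => i _; rewrite liftK mxE.
Qed.

End LinearCombinations.

Lemma eval_lincomb (n : nat) (t : term mul_language n) :
  exists e : 'rV[int]_n, forall v : valuation n, eval v t = lincomb e v.
Proof.
elim: t => [i|[] ts IHt].
- by exists (delta_mx 0 i) => v; rewrite lincomb_delta.
- by exists 0 => v; rewrite lincomb0.
- have [[e eE] [f fE]] := (IHt ord0, IHt ord_max).
  by exists (e + f) => v; rewrite lincombD -eE -fE.
- by have [e eE] := IHt ord0; exists (- e) => v; rewrite lincombN -eE.
Qed.

Section TermOperations.

Variable n : nat.
Implicit Types t : term mul_language n.

Definition one_term : term mul_language n :=
  @App mul_language n OneSymb (fun i => match notF (ltn_ord i) with end).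

Definition mul_term s t : term mul_language n :=
  @App mul_language n MulSymb (fun i => if i == ord0 then s else t).

Definition inv_term t : term mul_language n :=
  @App mul_language n InvSymb (fun _ => t).

(** Functions given by terms include the coordinates and are closed under the group operations. *)
Lemma lincomb_term (e : 'rV[int]_n) :
  exists t, forall v : valuation n, eval v t = lincomb e v.
Proof.
pose termdef (f : valuation n -> Qpos) := exists t, forall v, eval v t = f v.
have def0 : termdef (fun=> 0) by exists one_term.
have defD f g : termdef f -> termdef g -> termdef (fun v => f v + g v).
  by move=> [s sE] [t tE]; exists (mul_term s t) => v; rewrite -sE -tE.
have defN f : termdef f -> termdef (fun v => - f v).
  by move=> [t tE]; exists (inv_term t) => v; rewrite -tE.
have defMn f k : termdef f -> termdef (fun v => f v *+ k).
  move=> deff; elim: k => [|k [t tE]]; first by [].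
  by have [u uE] := defD _ _ deff (ex_intro _ t tE); exists u => v; rewrite uE mulrS.
have defMz f (k : int) : termdef f -> termdef (fun v => f v *~ k).
  move=> deff; case: k => k; first exact: defMn.
  by have [t tE] := defN _ (defMn _ k.+1 deff); exists t => v; rewrite tE NegzE -nmulrn.
rewrite /lincomb; elim: (index_enum _) => [|i r [t tE]].
  by have [t tE] := def0; exists t => v; rewrite big_nil tE.
have [u uE] : termdef (fun v => v i *~ e 0 i) by apply: defMz; exists (Var i).
have [w wE] := defD _ _ (ex_intro _ u uE) (ex_intro _ t tE).
by exists w => v; rewrite wE big_cons.
Qed.

End TermOperations.

(** * Quantifier-free definable relations *)

Definition definable (n : nat) (P : ('I_n -> Qpos) -> Prop) : Prop :=
  exists psi : formula mul_language n,
    quantifier_free psi /\ forall v : valuation n, sat psi v <-> P v.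

Section Definable.

Variable n : nat.
Implicit Types P Q : ('I_n -> Qpos) -> Prop.

Lemma definable_ext P Q : (forall v, P v <-> Q v) -> definable P -> definable Q.
Proof.
move=> PQ [psi [qf_psi psiP]]; exists psi; split=> // v.
by rewrite psiP.
Qed.

Lemma definable_false : definable (fun _ : 'I_n -> Qpos => False).
Proof. by exists FFalse. Qed.

Lemma definable_and P Q :
  definable P -> definable Q -> definable (fun v => P v /\ Q v).
Proof.
move=> [p [qp pP]] [q [qq qP]]; exists (FAnd p q); split; first exact/andP.
by move=> v; rewrite /= pP qP.
Qed.

Lemma definable_or P Q :
  definable P -> definable Q -> definable (fun v => P v \/ Q v).
Proof.
move=> [p [qp pP]] [q [qq qP]]; exists (FOr p q); split; first exact/andP.
by move=> v; rewrite /= pP qP.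
Qed.

Lemma definable_imp P Q :
  definable P -> definable Q -> definable (fun v => P v -> Q v).
Proof.
move=> [p [qp pP]] [q [qq qP]]; exists (FImp p q); split; first exact/andP.
by move=> v; rewrite /= pP qP.
Qed.

Lemma definable_not P : definable P -> definable (fun v => ~ P v).
Proof. by move=> defP; apply: definable_imp defP definable_false. Qed.

Lemma definable_true : definable (fun _ : 'I_n -> Qpos => True).
Proof.
by apply: definable_ext (definable_not definable_false) => v; split=> // _ [].
Qed.

(** Serves for divisibility conditions between moduli, which do not depend on the valuation. *)
Lemma definable_bool (b : bool) : definable (fun _ : 'I_n -> Qpos => b).
Proof.
by case: b; [apply: definable_ext definable_true | apply: definable_ext definable_false].
Qed.

Lemma definable_forall_in (T : eqType) (s : seq T) (P : T -> ('I_n -> Qpos) -> Prop) :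
  (forall x, definable (P x)) -> definable (fun v => forall x, x \in s -> P x v).
Proof.
move=> defP; elim: s => [|y s IHs]; first exact: definable_ext definable_true.
apply: definable_ext (definable_and (defP y) IHs) => v; split=> [[Py sP] x|sP].
  by rewrite inE => /orP[/eqP-> //|]; apply: sP.
by split=> [|x xs]; apply: sP; rewrite inE ?eqxx ?xs ?orbT.
Qed.

Lemma definable_exists_in (T : eqType) (s : seq T) (P : T -> ('I_n -> Qpos) -> Prop) :
  (forall x, definable (P x)) ->
  definable (fun v => exists2 x, x \in s & P x v).
Proof.
move=> defP; elim: s => [|y s IHs].
  by apply: definable_ext definable_false => v; split=> // -[].
apply: definable_ext (definable_or (defP y) IHs) => v; split.
  by case=> [Py|[x xs Px]]; [exists y | exists x]; rewrite // inE ?eqxx ?xs ?orbT.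
by case=> x; rewrite inE => /orP[/eqP-> |]; [left | right; exists x].
Qed.

(** Modulus [0] gives an equation and modulus [1] a truth; moduli from [2] on have a relation
    symbol. *)
Lemma definable_multiple (m : nat) (e : 'rV[int]_n) :
  definable (fun v => multiple m (lincomb e v)).
Proof.
have [t tE] := lincomb_term e; case: m => [|[|m]].
- by exists (FEq t (one_term n)); split=> // v; rewrite multiple0P -tE.
- by apply: definable_ext definable_true => v; split=> // _; apply: multiple1.
- exists (@FRel mul_language n (exist _ m.+2 isT) (fun _ => t)); split=> // v.
  by rewrite /= tE Qpos_powerE.
Qed.

(** The criterion [exists_congruences] no longer mentions [u] and is a finite Boolean combination of
    conditions [multiple m (lincomb e v)]. *)
Lemma definable_congruences (P N : seq ('rV[int]_n * nat)) :
  definable (fun v => exists u : Qpos,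
    (forall c, c \in P -> multiple c.2 (u - lincomb c.1 v)) /\
    (forall c, c \in N -> ~ multiple c.2 (u - lincomb c.1 v))).
Proof.
pose compat (c d : 'rV[int]_n * nat) (v : 'I_n -> Qpos) :=
  multiple (gcdn c.2 d.2) (lincomb c.1 v - lincomb d.1 v).
have def_compat c d : definable (compat c d).
  apply: definable_ext (definable_multiple (gcdn c.2 d.2) (c.1 - d.1)) => v.
  by rewrite lincombB.
have defP := definable_forall_in P (fun c => definable_forall_in P (def_compat c)).
have defN := definable_forall_in N (fun d => definable_imp
  (definable_bool (d.2 %| \big[lcmn/1%N]_(c <- P) c.2)%N)
  (definable_not (definable_forall_in P (def_compat^~ d)))).
apply: definable_ext (definable_and defP defN) => v.
pose ev (c : 'rV[int]_n * nat) := (lincomb c.1 v, c.2).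
have := exists_congruences Qpos_torsion_free Qpos_fresh (map ev P) (map ev N).
rewrite big_map /= => exE; split=> [[comP comN]|[u [uP uN]]].
  have [|u [/forall_in_map uP /forall_in_map uN]] := exE.2; last by exists u.
  split; first by apply/forall_in_map => c cP; apply/forall_in_map; apply: comP.
  apply/forall_in_map => d dN dvd_d /forall_in_map; exact: comN.
have [|comP comN] := exE.1; first by exists u; split; apply/forall_in_map.
split=> [c cP|d dN dvd_d comPd].
  by move/forall_in_map: comP => /(_ c cP) /forall_in_map.
by move/forall_in_map: comN => /(_ d dN dvd_d); apply; apply/forall_in_map.
Qed.

End Definable.

(** * Eliminating a variable from a conjunction of literals *)

(* [(b, (m, e))] asserts, or denies when [b] is [false], that the combination
   [e] of the variables is an [m]-fold multiple. *)
Notation literal n := (bool * (nat * 'rV[int]_n))%type.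

Definition lit_sat (n : nat) (l : literal n) (v : 'I_n -> Qpos) : Prop :=
  if l.1 then multiple l.2.1 (lincomb l.2.2 v)
  else ~ multiple l.2.1 (lincomb l.2.2 v).

Lemma definable_lit_sat (n : nat) (l : literal n) : definable (lit_sat l).
Proof.
case: l => [[] [m e]]; first exact: definable_multiple.
exact: definable_not (definable_multiple m e).
Qed.

(* Multiplying the literals through makes all the nonzero coefficients of the
   quantified variable [x] equal to a common multiple [K], and [x *+ K] may then
   be replaced with an unknown [u] subject to the congruence [u = 0] modulo [K]. *)
Lemma definable_ex_literals (n : nat) (c : seq (literal n.+1)) :
  definable (fun v : 'I_n -> Qpos =>
    exists x : Qpos, forall l, l \in c -> lit_sat l (extend x v)).
Proof.
pose k (l : literal n.+1) := l.2.2 0 ord0.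
pose tl (l : literal n.+1) := col' ord0 l.2.2.
pose c0 := [seq l <- c | k l == 0]; pose c1 := [seq l <- c | k l != 0].
(* The quotient [q l] carries the sign of [k l], so [k l * q l] is exactly [K]. If no literal
   involves [x], then [K] is [1]. *)
pose K := (\prod_(l <- c1) `|k l|)%N; pose q l := (K %/ k l)%Z.
have K_gt0 : (0 < K)%N.
  rewrite /K big_seq; apply: prodn_cond_gt0 => l.
  by rewrite mem_filter absz_gt0 => /andP[].
have kqE l : l \in c1 -> k l * q l = K.
  by move=> lc1; rewrite mulrC divzK // dvdzE /K (big_rem l) //= dvdn_mulr.
have q_neq0 l : l \in c1 -> q l != 0.
  move=> /kqE kq; apply: contraTneq K_gt0 => q0.
  by move: kq; rewrite q0 mulr0 => -[<-].
(* Multiplying by [q l] turns the leading term into [x *+ K]; the rest, moved across, changes sign,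
   and the modulus is scaled along. *)
pose conv l : 'rV[int]_n * nat := (- (q l *: tl l), (l.2.1 * `|q l|)%N).
have convE l x v : l \in c1 -> multiple l.2.1 (lincomb l.2.2 (extend x v)) <->
    multiple (conv l).2 (x *+ K - lincomb (conv l).1 v).
  move=> lc1; rewrite (multiple_mulz Qpos_torsion_free _ _ (q_neq0 l lc1)).
  rewrite lincomb_extend mulrzDl -mulrzA kqE // -pmulrn /=.
  by rewrite lincombN lincombZ opprK.
have lit0E l x v : l \in c0 ->
    lit_sat l (extend x v) <-> lit_sat (l.1, (l.2.1, tl l)) v.
  rewrite mem_filter => /andP[/eqP kl0 _].
  by rewrite /lit_sat lincomb_extend [_ 0 ord0]kl0 mulr0z add0r.
pose P := (0, K) :: [seq conv l | l <- c1 & l.1].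
pose N := [seq conv l | l <- c1 & ~~ l.1].
have def0 := definable_forall_in c0
  (fun l => definable_lit_sat (l.1, (l.2.1, tl l))).
apply: definable_ext (definable_and def0 (definable_congruences P N)) => v.
split=> [[sat0 [u [uP uN]]]|[x xsat]].
  have [x uE] : multiple K u.
    by have := uP (0, K); rewrite mem_head lincomb0 subr0; apply.
  exists x => l lc; have [kl0|kl0] := eqVneq (k l) 0.
    have lc0 : l \in c0 by rewrite mem_filter kl0 eqxx.
    by apply/(lit0E l x v lc0); apply: sat0.
  have lc1 : l \in c1 by rewrite mem_filter kl0.
  rewrite /lit_sat; case: ifPn => l1.
    apply/convE => //; rewrite -uE; apply: uP.
    by rewrite inE map_f ?orbT // mem_filter l1.
  rewrite convE // -uE; apply: uN.
  by rewrite map_f // mem_filter l1.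
split=> [l lc0|].
  by apply/(lit0E l x v lc0)/xsat; move: lc0; rewrite mem_filter => /andP[].
have litP l : l \in c1 -> lit_sat l (extend x v).
  by rewrite mem_filter => /andP[_]; apply: xsat.
exists (x *+ K); split=> d.
  rewrite inE => /orP[/eqP->|/mapP[l]].
    by rewrite lincomb0 subr0; exists x.
  rewrite mem_filter => /andP[l1 lc1] ->; apply/convE => //.
  by have := litP l lc1; rewrite /lit_sat l1.
move=> /mapP[l]; rewrite mem_filter => /andP[l1 lc1] ->; rewrite -convE //.
by have := litP l lc1; rewrite /lit_sat (negPf l1).
Qed.

(** * Disjunctive normal forms *)

Definition has_dnf (n : nat) (P : ('I_n -> Qpos) -> Prop) : Prop :=
  exists D : seq (seq (literal n)), forall v,
    P v <-> exists2 c, c \in D & forall l, l \in c -> lit_sat l v.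

Section DisjunctiveNormalForms.

Variable n : nat.
Implicit Types P Q : ('I_n -> Qpos) -> Prop.

Lemma has_dnf_ext P Q : (forall v, P v <-> Q v) -> has_dnf P -> has_dnf Q.
Proof. by move=> PQ [D DP]; exists D => v; rewrite -PQ. Qed.

Lemma has_dnf_false : has_dnf (fun _ : 'I_n -> Qpos => False).
Proof. by exists [::] => v; split=> // -[]. Qed.

Lemma has_dnf_true : has_dnf (fun _ : 'I_n -> Qpos => True).
Proof. by exists [:: [::]] => v; split=> // _; exists [::]. Qed.

Lemma has_dnf_literal (l : literal n) : has_dnf (lit_sat l).
Proof.
exists [:: [:: l]] => v; split=> [lv|[c]].
  by exists [:: l] => [|l']; rewrite ?mem_head // inE => /eqP->.
by rewrite inE => /eqP-> /(_ l); apply; rewrite mem_head.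
Qed.

Lemma has_dnf_or P Q : has_dnf P -> has_dnf Q -> has_dnf (fun v => P v \/ Q v).
Proof.
move=> [D DP] [E EP]; exists (D ++ E) => v; rewrite DP EP; split.
  by case=> -[c cD cv]; exists c => //; rewrite mem_cat cD ?orbT.
by case=> c; rewrite mem_cat => /orP[] cD cv; [left | right]; exists c.
Qed.

Lemma has_dnf_and P Q : has_dnf P -> has_dnf Q -> has_dnf (fun v => P v /\ Q v).
Proof.
move=> [D DP] [E EP]; exists [seq c ++ d | c <- D, d <- E] => v.
rewrite DP EP; split=> [[[c cD cv] [d dE dv]]|[_ /allpairsP[[c d] /= [cD dE ->]] cdv]].
  exists (c ++ d); first by apply/allpairsP; exists (c, d).
  by move=> l; rewrite mem_cat => /orP[/cv|/dv].
by split; [exists c | exists d] => // l lc; apply: cdv; rewrite mem_cat lc ?orbT.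
Qed.

End DisjunctiveNormalForms.

(** An implication needs the normal form of its negated premise, so the induction carries a formula
    together with its negation. *)
Lemma quantifier_free_dnf (n : nat) (psi : formula mul_language n) :
  quantifier_free psi ->
  has_dnf (fun v : valuation n => sat psi v) /\
  has_dnf (fun v : valuation n => ~ sat psi v).
Proof.
have atom m (P : ('I_m -> Qpos) -> Prop) k e :
    (forall v, P v <-> multiple k (lincomb e v)) ->
    has_dnf P /\ has_dnf (fun v => ~ P v).
  move=> PE; split.
    by apply: has_dnf_ext (has_dnf_literal (true, (k, e))) => v; rewrite PE.
  by apply: has_dnf_ext (has_dnf_literal (false, (k, e))) => v; rewrite PE.
elim: psi => {n} [n|n s t|n r ts|n p IHp q IHq|n p IHp q IHq|n p IHp q IHq|//|//].
- split; first exact: has_dnf_false.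
  by apply: has_dnf_ext (has_dnf_true n) => v; split=> // _ [].
- have [[e eE] [f fE]] := (eval_lincomb s, eval_lincomb t) => _.
  apply: (atom _ _ 0%N (e - f)) => v; rewrite multiple0P lincombB -eE -fE /=.
  by split=> [->|/eqP]; rewrite ?subrr // subr_eq0 => /eqP.
- have [e eE] := eval_lincomb (ts ord0) => _.
  apply: (atom _ _ (sval r) e) => v; rewrite -eE /= Qpos_powerE //.
  by apply: leq_trans (valP r).
- move=> /= /andP[/IHp[pP pN] /IHq[qP qN]]; split; first exact: has_dnf_and.
  apply: has_dnf_ext (has_dnf_or pN qN) => v.
  by split=> [|/not_and_or//]; tauto.
- move=> /= /andP[/IHp[pP pN] /IHq[qP qN]]; split; first exact: has_dnf_or.
  by apply: has_dnf_ext (has_dnf_and pN qN) => v; tauto.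
- move=> /= /andP[/IHp[pP pN] /IHq[qP qN]]; split.
    apply: has_dnf_ext (has_dnf_or pN qP) => v.
    by split=> [|/imply_to_or//]; tauto.
  apply: has_dnf_ext (has_dnf_and pP qN) => v.
  split=> [[pv nqv] pq|npq]; first exact: nqv (pq pv).
  exact: imply_to_and npq.
Qed.

(** * Quantifier elimination in the structure *)

(** The existential quantifier distributes over the disjunction of a normal form, leaving one
    conjunction of literals at a time. *)
Lemma definable_ex (n : nat) (P : ('I_n.+1 -> Qpos) -> Prop) :
  definable P -> definable (fun v => exists x : Qpos, P (extend x v)).
Proof.
move=> [psi [/quantifier_free_dnf[[D DP] _] psiP]].
apply: definable_ext (definable_exists_in D (@definable_ex_literals n)) => v.
split=> [[c cD [x xP]]|[x /psiP/DP[c cD xP]]]; last by exists c => //; exists x.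
by exists x; apply/psiP/DP; exists c.
Qed.

Lemma definable_sat (n : nat) (phi : formula mul_language n) :
  definable (fun v : valuation n => sat phi v).
Proof.
elim: phi => {n} [n|n s t|n r ts|n p IHp q IHq|n p IHp q IHq|n p IHp q IHq|n p IHp|n p IHp].
- by exists FFalse.
- by exists (FEq s t).
- by exists (FRel r ts).
- exact: definable_and.
- exact: definable_or.
- exact: definable_imp.
(* Classically, a universal quantifier is a negated existential one. *)
- apply: definable_ext (definable_not (definable_ex (definable_not IHp))) => v.
  by split=> [nex x|all_p [x]]; [apply: NNPP => np; apply: nex; exists x | apply].
- exact: definable_ex.
Qed.

(** * From the structure to its theory *)

(** A theory contains only sentences, so a formula is closed before it is transferred to another
    model. *)
Fixpoint universal_closure (L : language) (n : nat) : formula L n -> formula L 0 :=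
  match n with
  | 0 => id
  | n'.+1 => fun phi => universal_closure (FAll phi)
  end.

Lemma extend_eta (T : Type) (n : nat) (v : 'I_n.+1 -> T) :
  extend (v ord0) (fun i => v (lift ord0 i)) = v.
Proof.
by apply: functional_extensionality => i; rewrite /extend; case: unliftP => [j|] ->.
Qed.

Lemma holds_universal_closure (L : language) (M : structure L) (n : nat)
    (phi : formula L n) :
  holds M (universal_closure phi) <-> forall v : 'I_n -> M, sat phi v.
Proof.
elim: n phi => [|n IHn] phi /=.
  split=> [phi0 v|]; last exact.
  suff -> : v = @no_var M by [].
  by apply: functional_extensionality; case.
rewrite IHn; split=> [allphi v|allphi v x]; last exact: allphi.
by rewrite -(extend_eta v); apply: allphi.
Qed.

(* The theory of a structure is complete: an equivalence valid in the structure
   is valid in all models of its theory. *)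
Lemma entails_theory_of (L : language) (M : structure L) (n : nat)
    (phi : formula L n) :
  (forall v : 'I_n -> M, sat phi v) -> entails (theory_of M) phi.
Proof.
by move=> /holds_universal_closure phiM M' modM'; apply/holds_universal_closure/modM'.
Qed.

Theorem theorem4 :
  admits_quantifier_elimination (theory_of Qpos_structure).
Proof.
move=> n phi; have [psi [qf_psi psiP]] := definable_sat phi.
exists psi; split=> //; apply: entails_theory_of => v.
by split=> /psiP.
Qed.
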